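(* Let $(X,\mathcal{A},\mu)$ be a measure space. Any atom $A$ in $(X,\mathcal{A},\mu)$ is a $\mu$-bounded subset of $X$.
   Context: $X$ is a non-empty set, $\mathcal{A}$ a $\sigma$-algebra on $X$, $\mu:\mathcal{A}\to[0,\infty]$ a measure; $\mathcal{M}(X,\mathcal{A})$ is the set of all measurable functions $X\to\mathbb{R}$. An atom is a set $A\in\mathcal{A}$ with $\mu(A)>0$ that cannot be written as a disjoint union $A=B\sqcup C$ with $B,C\in\mathcal{A}$ and $\mu(B)>0$, $\mu(C)>0$. A subset $Y\subseteq X$ is $\mu$-bounded if for every $f\in\mathcal{M}(X,\mathcal{A})$ there is a set $E\in\mathcal{A}$ with $\mu(E)=0$ such that $f$ is bounded on $Y\setminus E$. *)

(* Defs.v *)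
From HB Require Import structures.
From mathcomp Require Import all_boot all_order all_algebra.
From mathcomp Require Import all_classical all_reals all_analysis.
Import Order.TTheory GRing.Theory Num.Theory.
Import numFieldNormedType.Exports.

Set Implicit Arguments.
Unset Strict Implicit.
Unset Printing Implicit Defensive.

Local Open Scope classical_set_scope.
Local Open Scope ring_scope.
Local Open Scope ereal_scope.

Definition is_atom (d : measure_display) (X : measurableType d)
    (R : realType) (mu : {measure set X -> \bar R}) (A : set X) : Prop :=
  [/\ measurable A, 0 < mu A &
    ~ exists B C : set X,
        [/\ measurable B, measurable C, A = B `|` C & B `&` C = set0] /\
        (0 < mu B /\ 0 < mu C)].

Definition mu_bounded (d : measure_display) (X : measurableType d)
    (R : realType) (mu : {measure set X -> \bar R}) (Y : set X) : Prop :=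
  forall f : X -> R, measurable_fun setT f ->
    exists E : set X,
      [/\ measurable E, mu E = 0 & [bounded f x | x in Y `\` E]].

(* Main.v *)
Require Import Defs.
From HB Require Import structures.
From mathcomp Require Import all_boot all_order all_algebra.
From mathcomp Require Import all_classical all_reals all_analysis.
Import Order.TTheory GRing.Theory Num.Theory.
Import numFieldNormedType.Exports.

Local Open Scope classical_set_scope.
Local Open Scope ring_scope.

(** A measurable set cuts an atom into two pieces, one of which is null ([atom_null_or_conull]). Cut
    [A] by the sublevel sets of [|f|]: since [f] is real-valued they exhaust [A], so by countable
    subadditivity they cannot all meet [A] in null sets. Hence some level [n] leaves out only a null
    part of [A], and [n] bounds [|f|] on the rest. *)

Lemma atom_null_or_conull {d : measure_display} {X : measurableType d}
    {R : realType} {mu : {measure set X -> \bar R}} {A B : set X} :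
  is_atom mu A -> measurable B -> mu (A `&` B) = 0%E \/ mu (A `\` B) = 0%E.
Proof.
move=> [mA _ indec] mB.
have [|IB0] := eqVneq (mu (A `&` B)) 0%E; first by left.
have [|DB0] := eqVneq (mu (A `\` B)) 0%E; first by right.
(* Two non-null pieces would be a forbidden splitting of [A]. *)
exfalso; apply: indec; exists (A `&` B), (A `\` B); split; last first.
  by rewrite !lt0e IB0 DB0 !measure_ge0.
split.
- exact: measurableI.
- exact: measurableD.
- by rewrite setUIDK.
- by rewrite setDE setIACA setICr setI0.
Qed.

(* If no sublevel set [`|f| <= n] were conull in A, each would be null in A, and
   A, their countable union, would be null. *)
Theorem lemma7p4p3 (d : measure_display) (X : measurableType d) (R : realType)
    (mu : {measure set X -> \bar R}) (A : set X) :
  is_atom mu A -> mu_bounded mu A.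
Proof.
move=> atomA f mf; have [mA A_gt0 _] := atomA.
pose L (n : nat) := [set x | `|f x| <= n%:R].
have mL n : measurable (L n).
  rewrite -[L n]setTI (_ : L n = f @^-1` `[- n%:R, n%:R]); first exact: mf.
  by apply/seteqP; split => x /=; rewrite /L/= in_itv/= ler_norml.
have [[n Ln0]|noL] := pselect (exists n, mu (A `\` L n) = 0%E).
  (* Removing this null set from [A] leaves [A]&[L n], where [|f| <= n]. *)
  exists (A `\` L n); split => //; first exact: measurableD.
  exists n%:R; split; first exact: realn.
  by move=> M /ltW nM x; rewrite setDD => -[_ /le_trans]; apply.
have AL0 n : mu (A `&` L n) = 0%E.
  by have [//|Ln0] := atom_null_or_conull atomA (mL n); case: noL; exists n.
have AE : A = \bigcup_n (A `&` L n).
  rewrite -setI_bigcupr; apply/esym/setIidl => x _.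
  (* By the Archimedean property, each [x] lies in some [L n]. *)
  by exists (Num.bound `|f x|) => //; rewrite /L/= ltW// archi_boundP.
have : mu.-negligible A.
  rewrite AE; apply: negligible_bigcup => n.
  by apply/negligibleP; [exact: measurableI|exact: AL0].
by move=> /(measure_negligible mA) A0; move: A_gt0; rewrite A0 ltxx.
Qed.
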